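(* Let $k\ge 2$ be an integer. For any $(u,v)\in\Delta_k$, $$\mathbb{E}[Y_k(u,v)]=\mathbb{E}[X_k(u,v)]=uv$$ and $$\mathbb{V}[Y_k(u,v)]=\frac{1}{k!+1}\,\mathbb{V}[X_k(u,v)]=\frac{uv(1-u)(1-v)}{(k!+1)(k-1)},$$ where $\mathbb{E}$ and $\mathbb{V}$ denote expected value and variance.
   Context: Fix an integer $k\ge 2$. Let $[k]=\{1,\dots,k\}$, $\delta_k=\{0,\tfrac1k,\dots,\tfrac{k-1}{k},1\}$ and $\Delta_k=\delta_k\times\delta_k$. Let $\mathcal{S}_k$ be the set of all permutations of $[k]$. For $\pi\in\mathcal{S}_k$, let $C_\pi\colon\Delta_k\to[0,1]$ be the discrete copula with mass $\tfrac1k$ in each square $[\tfrac{i-1}{k},\tfrac ik]\times[\tfrac{\pi(i)-1}{k},\tfrac{\pi(i)}{k}]$, $i\in[k]$, and mass $0$ in all other squares of the mesh; that is, $C_\pi(\tfrac ik,\tfrac jk)=\tfrac1k\,|\{m\in[k] : m\le i,\ \pi(m)\le j\}|$ for $i,j\in\{0,1,\dots,k\}$. The random discrete copula induced by a permutation, $X_k$, is the random field over $\Delta_k$ given by $X_k(u,v)=C_\pi(u,v)$, where $\pi$ is chosen uniformly at random from $\mathcal{S}_k$. Let $\sigma^{k!-1}=\{(\alpha_\pi)_{\pi\in\mathcal{S}_k}\in\mathbb{R}^{k!} : \alpha_\pi\ge 0 \text{ for all } \pi,\ \sum_{\pi\in\mathcal{S}_k}\alpha_\pi=1\}$ be the standard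 simplex. The random discrete copula $Y_k$ is the random field over $\Delta_k$ given by $Y_k(u,v)=\sum_{\pi\in\mathcal{S}_k}\alpha_\pi C_\pi(u,v)$, where $\boldsymbol{\alpha}=(\alpha_\pi)_{\pi\in\mathcal{S}_k}$ is chosen uniformly at random from $\sigma^{k!-1}$ with respect to the Lebesgue measure on the simplex (equivalently, $\boldsymbol{\alpha}$ has the Dirichlet distribution with all $k!$ parameters equal to $1$). *)

(* Defs.v *)
From HB Require Import structures.
From mathcomp Require Import all_boot all_order all_algebra all_fingroup.
From mathcomp Require Import all_classical all_reals all_analysis.

Set Implicit Arguments.
Unset Strict Implicit.
Unset Printing Implicit Defensive.

Import Order.TTheory GRing.Theory Num.Theory.
Import numFieldNormedType.Exports.

Local Open Scope classical_set_scope.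
Local Open Scope ring_scope.

(* The mesh point (i/k, j/k) is represented by the pair (i, j) : 'I_k.+1 * 'I_k.+1.
   An element m of 'I_k stands for m.+1 in [k] = {1, ..., k}, so that m.+1 <= i
   reads m < i. *)
Definition discrete_copula (R : realType) (k : nat) (s : {perm 'I_k})
    (i j : 'I_k.+1) : R :=
  k%:R^-1 * #|[set m : 'I_k | (m < i)%N && (s m < j)%N]%SET|%:R.

(* {perm 'I_k} carries the discrete sigma-algebra. *)
Definition uniform_perm (R : realType) (k : nat) (d : measure_display)
    (T : measurableType d) (P : probability T R) (s : T -> {perm 'I_k}) : Prop :=
  forall t : {perm 'I_k},
    measurable (s @^-1` [set t]) /\
    P (s @^-1` [set t]) = (#|{: {perm 'I_k}}|%:R^-1)%:E.

Definition cons_pair (R : realType) (n : nat)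
    (p : measurableTypeR R * n.-tuple R) : n.+1.-tuple R :=
  [tuple of p.1 :: p.2].

(* Lebesgue measure on R^n: the n-fold product of the one-dimensional one. *)
Fixpoint lebesgue_tuple (R : realType) (n : nat) : set (n.-tuple R) -> \bar R :=
  match n with
  | 0 => \d_([tuple] : 0.-tuple R)
  | m.+1 =>
      pushforward (@lebesgue_measure R \x @lebesgue_tuple R m)%E
        (@cons_pair R m)
  end.

Definition std_simplex (R : realType) (n : nat) : set (n.-tuple R) :=
  [set a | (forall i, 0 <= tnth a i) /\ \sum_(i < n) tnth a i = 1].

(* For 0 < n, the affine bijection from R^(n-1) onto the hyperplane of R^n of
   the points whose coordinates sum to 1: coordinate 0 is solved for. *)
Definition hyperplane_chart (R : realType) (n : nat) (x : n.-1.-tuple R) :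
    n.-tuple R :=
  [tuple nth 0 ((1 - \sum_(y <- x) y) :: x) i | i < n].

(* Lebesgue measure on that hyperplane. Another affine chart, or the Euclidean
   normalization, changes it only by a constant factor, which cancels in
   uniform_simplex. *)
Definition hyperplane_lebesgue (R : realType) (n : nat) :
    set (n.-tuple R) -> \bar R :=
  pushforward (@lebesgue_tuple R n.-1) (@hyperplane_chart R n).

Definition uniform_simplex (R : realType) (n : nat) (d : measure_display)
    (T : measurableType d) (P : probability T R)
    (a : {RV P >-> n.-tuple R}) : Prop :=
  forall A : set (n.-tuple R), measurable A ->
    distribution P a A =
    (hyperplane_lebesgue (A `&` @std_simplex R n) *
     (fine (hyperplane_lebesgue (@std_simplex R n)))^-1%:E)%E.

(* The coordinates of R^(k!) are indexed by permutations through enum_rank. *)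
Definition weight (R : realType) (k : nat) (a : #|{: {perm 'I_k}}|.-tuple R)
    (s : {perm 'I_k}) : R :=
  tnth a (enum_rank s).

Definition random_copula_X (R : realType) (k : nat) (T : Type)
    (s : T -> {perm 'I_k}) (i j : 'I_k.+1) : T -> R :=
  fun w => discrete_copula R (s w) i j.

Definition random_copula_Y (R : realType) (k : nat) (T : Type)
    (a : T -> #|{: {perm 'I_k}}|.-tuple R) (i j : 'I_k.+1) : T -> R :=
  fun w => \sum_(s : {perm 'I_k}) weight (a w) s * discrete_copula R s i j.

(* Main.v *)
Require Import Defs.
From HB Require Import structures.
From mathcomp Require Import all_boot all_order all_algebra all_fingroup.
From mathcomp Require Import all_classical all_reals all_analysis.
From mathcomp Require Import measurable_realfun ring.

Set Implicit Arguments.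
Unset Strict Implicit.
Unset Printing Implicit Defensive.

Import Order.TTheory GRing.Theory Num.Theory.
Import numFieldNormedType.Exports.

Local Open Scope classical_set_scope.
Local Open Scope ring_scope.

(**
  Solving the first coordinate of the simplex and applying Tonelli one coordinate
  at a time gives Dirichlet's formula: the integral over [x_i >= 0], [sum x <= t]
  of [prod x_i^(p_i) * (t - sum x)^q] is
  [prod p_i! * q! / (n + sum p + q)! * t^(n + sum p + q)].
  It yields the moments of order at most 2 of the uniform distribution on the
  simplex with [N] vertices: [E a_i = 1/N] and
  [E (a_i a_j) = (1 + [i = j]) / (N (N + 1))]. Hence [Y = sum a_s c_s] has the
  same mean as [c_s] for a uniform [s], and [1 / (N + 1)] times its variance.
  The mean and the variance of [C_s(i/k, j/k)], which is [1/k] times the sum over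
  [m] of [[m < i] [s m < j]], follow from the invariance of the uniform
  permutation under transpositions.
*)

(** * Lebesgue measure on tuples as a sigma-finite measure *)

Lemma measurable_cons_pair (R : realType) (n : nat) :
  measurable_fun setT (@cons_pair R n).
Proof. exact: measurable_cons. Qed.

Section lebesgue_cons.
Context (R : realType) (n : nat).
Variable mu : {sigma_finite_measure set (n.-tuple R) -> \bar R}.

(** One step of the recursion in [lebesgue_tuple], with [mu] bundled as sigma-finite, which is what
    Tonelli's theorem asks of each factor. *)
Definition lebesgue_cons : set (n.+1.-tuple R) -> \bar R :=
  pushforward (@lebesgue_measure R \x mu)%E (@cons_pair R n).

Let lebesgue_cons_pushforward : {measure set (n.+1.-tuple R) -> \bar R} :=
  measure_function_pushforward__canonical__measure_function_Measure
    (@lebesgue_measure R \x mu)%E (@measurable_cons_pair R n).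

HB.instance Definition _ := isMeasure.Build _ _ _ lebesgue_cons
  (measure0 lebesgue_cons_pushforward) (measure_ge0 lebesgue_cons_pushforward)
  (@measure_semi_sigma_additive _ _ _ lebesgue_cons_pushforward).

(* The analogous instance for [\x] in the library is shadowed by the one for
   subprobabilities, so the boxes are exhibited again here. *)
Let lebesgue_cons_sigma_finite : sigma_finite setT lebesgue_cons.
Proof.
pose uncons (x : n.+1.-tuple R) : (measurableTypeR R * n.-tuple R)%type :=
  (tnth x ord0, [tuple of behead x]).
have uncons_cons x : uncons (cons_pair x) = x.
  by rewrite /uncons /cons_pair; case: x => a x /=; congr pair; exact/val_inj.
have muncons : measurable_fun setT uncons.
  apply/measurable_fun_pairP; split; [exact: measurable_tnth|exact: measurable_behead].
have /sigma_finiteP[F [TF ndF Foo]] := sigma_finiteT (@lebesgue_measure R).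
have /sigma_finiteP[G [TG ndG Goo]] := sigma_finiteT mu.
exists (fun i => uncons @^-1` (F i `*` G i)).
  rewrite -preimage_bigcup; apply/esym/seteqP; split => // x _.
  have [i _ Fi] : (\bigcup_i F i) (tnth x ord0) by rewrite -TF.
  have [j _ Gj] : (\bigcup_i G i) [tuple of behead x] by rewrite -TG.
  exists (maxn i j) => //; split.
  - exact: (subsetPset _ _ (ndF _ _ (leq_maxl i j))).
  - exact: (subsetPset _ _ (ndG _ _ (leq_maxr i j))).
move=> i; have [mF Fi] := Foo i; have [mG Gi] := Goo i; split.
  by rewrite -[X in measurable X]setTI; apply: muncons => //; exact: measurableX.
(* The pushforward evaluates the product measure at a double preimage, which is the box itself
   because [uncons] undoes [cons_pair]. *)
apply: (eq_ind _ (fun A => ((@lebesgue_measure R \x mu) A < +oo)%E)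
  _ _ (_ : F i `*` G i = _)).
  by rewrite product_measure1E// lte_mul_pinfty// ge0_fin_numE.
by apply/funext => x; exact: (congr1 (F i `*` G i) (esym (uncons_cons x))).
Qed.

HB.instance Definition _ := Measure_isSigmaFinite.Build _ _ _ lebesgue_cons
  lebesgue_cons_sigma_finite.

Lemma ge0_integral_lebesgue_cons (f : n.+1.-tuple R -> \bar R) :
  measurable_fun [set: n.+1.-tuple R] f -> (forall x, (0 <= f x)%E) ->
  (\int[lebesgue_cons]_x f x =
   \int[@lebesgue_measure R]_x \int[mu]_y f [tuple of x :: y])%E.
Proof.
move=> mf f0.
rewrite (@ge0_integral_pushforward _ _ _ _ R _ (@measurable_cons_pair R n)
  (@lebesgue_measure R \x mu)%E setT f measurableT mf)//.
rewrite preimage_setT fubini_tonelli1//=.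
by apply: measurableT_comp => //; exact: measurable_cons_pair.
Qed.

End lebesgue_cons.

(** A copy of [lebesgue_tuple] that carries the sigma-finite structure through the recursion. *)
Fixpoint lebesgue_tuple_measure (R : realType) (n : nat) :
    {sigma_finite_measure set (n.-tuple R) -> \bar R} :=
  match n with
  | 0 => \d_([tuple] : 0.-tuple R)
  | m.+1 => lebesgue_cons (lebesgue_tuple_measure R m)
  end.

Lemma lebesgue_tuple_measureE (R : realType) (n : nat) :
  lebesgue_tuple_measure R n = @lebesgue_tuple R n :> (set _ -> \bar R).
Proof. by elim: n => //= n <-. Qed.

(** * Dirichlet's integral *)

(** Euler's Beta integral at integer arguments, by induction on [p] with [r] varying; the base case
    is the fundamental theorem of calculus. *)
Lemma integral_beta (R : realType) (t : R) (p r : nat) : 0 <= t ->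
  (\int[@lebesgue_measure R]_(x in `[0%R, t]) (x ^+ p * (t - x) ^+ r)%:E =
   (p`!%:R * r`!%:R / (p + r).+1`!%:R * t ^+ (p + r).+1)%:E)%E.
Proof.
rewrite le_eqVlt => /predU1P[<-|t0].
  by rewrite set_itv1 integral_set1 expr0n mulr0.
have cont q s : continuous (fun x : R => x ^+ q * (t - x) ^+ s).
  move=> x; apply: cvgM; first exact: exprn_continuous.
  apply: (@continuous_comp _ _ _ (fun x => t - x) (fun x => x ^+ s)).
    by apply: cvgB; [exact: cvg_cst|exact: cvg_id].
  exact: exprn_continuous.
elim: p r => [|p IHp] r.
  (* The antiderivative is built from operations on functions so that the derivation rules apply to
     it; [FE] gives its pointwise form. *)
  pose F : R -> R := - r.+1%:R^-1 \*: (cst t - id : R -> R) ^+ r.+1.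
  have FE x : F x = - r.+1%:R^-1 * (t - x) ^+ r.+1 by rewrite /F !fctE.
  have dF (x : R) : is_derive x 1 F ((t - x) ^+ r).
    apply: (is_derive_eq (is_deriveZ _
      (is_deriveX _ (is_deriveB (is_derive_cst t x 1) (is_derive_id x 1))))).
    rewrite sub0r /GRing.scale /= !fctE; field.
    by rewrite ?(natr1, nat1r) pnatr_eq0.
  have cF : continuous F.
    by move=> x; apply/differentiable_continuous/derivable1_diffP; case: (dF x).
  rewrite (@continuous_FTC2 _ _ F) //.
  - rewrite -EFinB !FE subrr expr0n mulr0 subr0 sub0r mulNr opprK add0n mul1r.
    rewrite factS natrM invfM mulrCA divff ?pnatr_eq0 -?lt0n ?fact_gt0//.
    by rewrite mulr1.
  - by apply: continuous_in_subspaceT => x _; exact: cont.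
  - split; first by move=> x _; case: (dF x).
    + exact/cvg_at_right_filter/cF.
    + exact/cvg_at_left_filter/cF.
  - by move=> x _; rewrite derive1E expr0 mul1r; case: (dF x).
have int q s : (@lebesgue_measure R).-integrable `[0, t]
    (fun x => (x ^+ q * (t - x) ^+ s)%:E).
  apply: continuous_compact_integrable; first exact: segment_compact.
  by apply: continuous_in_subspaceT => x _; exact: cont.
(* Splitting one factor [x] as [t - (t - x)] avoids integration by parts. *)
transitivity (\int[@lebesgue_measure R]_(x in `[0%R, t])
  (t%:E * (x ^+ p * (t - x) ^+ r)%:E - (x ^+ p * (t - x) ^+ r.+1)%:E))%E.
  by apply: eq_integral => x _; rewrite -EFinM -EFinB; congr EFin; rewrite !exprS; ring.
rewrite integralB//; last exact: integrableZl.
rewrite integralZl// !IHp -EFinM -EFinB; congr EFin.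
rewrite !addnS addSn !factS !natrM !exprS.
have pr0 : (p + r)`!%:R != 0 :> R by rewrite pnatr_eq0 -lt0n fact_gt0.
by field; rewrite pr0 -natrD nat1r -natrD !pnatr_eq0.
Qed.

Lemma measurable_tuple_sum (R : realType) (n : nat) :
  measurable_fun setT (fun x : n.-tuple R => \sum_(i < n) tnth x i).
Proof. by apply: measurable_sum => i; exact: measurable_tnth. Qed.

Lemma measurable_tuple_nonneg (R : realType) (n : nat) :
  measurable [set x : n.-tuple R | forall i, 0 <= tnth x i].
Proof.
rewrite (_ : [set _ | _] =
    \bigcap_(i in [set: 'I_n]) ((@tnth n R)^~ i @^-1` `[0, +oo[)).
  apply: fin_bigcap_measurable; first exact: finite_finset.
  by move=> i _; rewrite -[X in measurable X]setTI; exact: measurable_tnth.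
apply/seteqP; split => x /= x0 i; first by rewrite /= in_itv /= x0.
by have := x0 i I; rewrite /= in_itv /= andbT.
Qed.

(** At [t = 1] this is the standard simplex read in the chart. A general [t] serves the induction:
    fixing one coordinate at [x] leaves the bound [t - x]. *)
Definition corner_simplex (R : realType) (n : nat) (t : R) : set (n.-tuple R) :=
  [set x | (forall i, 0 <= tnth x i) /\ \sum_(i < n) tnth x i <= t].

Lemma measurable_corner_simplex (R : realType) (n : nat) (t : R) :
  measurable (@corner_simplex R n t).
Proof.
rewrite (_ : corner_simplex t = [set x | forall i, 0 <= tnth x i] `&`
    (fun x : n.-tuple R => \sum_(i < n) tnth x i) @^-1` `]-oo, t]).
  apply: measurableI; first exact: measurable_tuple_nonneg.
  by rewrite -[X in measurable X]setTI; exact: measurable_tuple_sum.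
by apply/seteqP; split => x [x0]; rewrite /= in_itv.
Qed.

Lemma sum_cons_tuple (R : realType) (n : nat) (x : R) (y : n.-tuple R) :
  \sum_(i < n.+1) tnth [tuple of x :: y] i = x + \sum_(i < n) tnth y i.
Proof.
by rewrite big_ord_recl tnth0; congr (_ + _); apply: eq_bigr => i _; rewrite tnthS.
Qed.

Lemma indic_corner_simplex_cons (R : realType) (n : nat) (t x : R)
    (y : n.-tuple R) :
  \1_(corner_simplex t) [tuple of x :: y] =
  (0 <= x)%R%:R * \1_(@corner_simplex R n (t - x)) y :> R.
Proof.
rewrite !indicE -natrM mulnb; congr (_%:R); congr nat_of_bool.
apply/idP/andP => [|[x0]]; rewrite !inE /corner_simplex /= sum_cons_tuple
    -lerBrDl.
  move=> [xy0 xyt]; split; first by have := xy0 ord0; rewrite tnth0.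
  by split => // i; have := xy0 (lift ord0 i); rewrite tnthS.
move=> [y0 yt]; split => // i.
by have [j ->|->] := unliftP ord0 i; rewrite ?tnthS ?tnth0.
Qed.

(** An unnormalized Dirichlet density: the power [q] belongs to the coordinate that was solved for.
    The indicator extends it by 0 to the whole space, where Tonelli applies. *)
Definition dirichlet_density (R : realType) (n : nat) (p : nat -> nat) (q : nat)
    (t : R) (x : n.-tuple R) : R :=
  \1_(corner_simplex t) x *
  ((\prod_(i < n) tnth x i ^+ p i) * (t - \sum_(i < n) tnth x i) ^+ q).

Lemma dirichlet_density_ge0 (R : realType) (n : nat) (p : nat -> nat) (q : nat)
    (t : R) (x : n.-tuple R) : 0 <= dirichlet_density p q t x.
Proof.
rewrite /dirichlet_density indicE; case: (boolP (x \in _)) => [|_]; last by rewrite mul0r.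
rewrite inE => -[x0 xt]; rewrite mul1r mulr_ge0 ?exprn_ge0 ?subr_ge0//.
by apply: prodr_ge0 => i _; rewrite exprn_ge0.
Qed.

Lemma measurable_dirichlet_density (R : realType) (n : nat) (p : nat -> nat)
    (q : nat) (t : R) :
  measurable_fun [set: n.-tuple R] (dirichlet_density p q t).
Proof.
apply: measurable_funM.
  by apply: measurable_indic; exact: measurable_corner_simplex.
apply: measurable_funM.
  by apply: measurable_prod => i _; apply: measurable_funX; exact: measurable_tnth.
apply: measurable_funX; apply: measurable_funB => //.
exact: measurable_tuple_sum.
Qed.

(** Integrating out all coordinates but the first leaves a power of [t - x], by induction, and then
    a Beta integral. Negative [t] must be covered, since [t - x] is negative for [x > t]. *)
Lemma integral_dirichlet (R : realType) (n : nat) (p : nat -> nat) (q : nat)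
    (t : R) :
  (\int[lebesgue_tuple_measure R n]_x (dirichlet_density p q t x)%:E =
   ((0 <= t)%R%:R *
    ((\prod_(i < n) (p i)`!)%:R * q`!%:R / (n + \sum_(i < n) p i + q)`!%:R) *
    t ^+ (n + \sum_(i < n) p i + q))%:E)%E.
Proof.
elim: n p t => [|n IHn] p t.
  rewrite /= integral_dirac//; last first.
    by apply/measurable_EFinP; exact: measurable_dirichlet_density.
  rewrite diracT mul1e /dirichlet_density !big_ord0 subr0 !add0n !mul1r.
  rewrite mulfV ?pnatr_eq0 -?lt0n ?fact_gt0// mulr1 indicE; congr (_%:R * _)%:E.
  congr nat_of_bool; apply/idP/idP; rewrite inE /corner_simplex/= big_ord0.
    by case.
  by move=> t0; split => // -[].
rewrite ge0_integral_lebesgue_cons; first last.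
- by move=> x; rewrite lee_fin dirichlet_density_ge0.
- by apply/measurable_EFinP; exact: measurable_dirichlet_density.
pose p' i := p i.+1; set m := (n + \sum_(i < n) p' i + q)%N.
pose C : R := (\prod_(i < n) (p' i)`!)%:R * q`!%:R / m`!%:R.
transitivity (\int[@lebesgue_measure R]_(x in `[0%R, t])
    (C%:E * (x ^+ p 0%N * (t - x) ^+ m)%:E))%E.
  rewrite [RHS]integral_mkcond; apply: eq_integral => x _.
  transitivity (\int[lebesgue_tuple_measure R n]_y
      (((0 <= x)%R%:R * x ^+ p 0%N)%:E * (dirichlet_density p' q (t - x) y)%:E))%E.
    apply: eq_integral => y _; rewrite -EFinM; congr EFin.
    rewrite /dirichlet_density indic_corner_simplex_cons sum_cons_tuple.
    rewrite big_ord_recl tnth0 opprD addrA.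
    by under eq_bigr do rewrite tnthS; ring.
  rewrite ge0_integralZl//; first last.
  - by rewrite lee_fin; case: (leP 0 x) => x0; rewrite ?mul1r ?mul0r ?exprn_ge0.
  - by move=> y _; rewrite lee_fin dirichlet_density_ge0.
  - by apply/measurable_EFinP; exact: measurable_dirichlet_density.
  (* The condition [0 <= x] and the condition [0 <= t - x] from the induction hypothesis together
     cut out the interval [[0, t]]. *)
  rewrite IHn -/m -/C patchE mem_setE in_itv /= subr_ge0 -EFinM.
  case: (0 <= x); case: (x <= t) => /=; rewrite ?(mul0r, mul1r, mulr0)//.
  by congr EFin; ring.
have [t0|t0] := leP 0 t; last first.
  by rewrite set_itv_ge ?bnd_simp -?ltNge// integral_set0 !mul0r.
rewrite ge0_integralZl//; first last.
- by rewrite lee_fin /C !mulr_ge0 ?invr_ge0 ?ler0n.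
- move=> x; rewrite /= in_itv /= => /andP[x0 xt].
  by rewrite lee_fin mulr_ge0 ?exprn_ge0 ?subr_ge0.
- apply/measurable_EFinP; apply: measurable_funM; first exact: measurable_funX.
  by apply: measurable_funX; exact: measurable_funB.
rewrite integral_beta// -EFinM; congr EFin; rewrite mul1r mulrA.
(* The factorial of [m] produced by the Beta integral cancels the denominator of [C]. *)
rewrite !big_ord_recl /= natrM /C.
have -> : (p 0%N + m).+1 = (n.+1 + (p 0%N + \sum_(i < n) p' i) + q)%N.
  by rewrite /m !addSn !addnA (addnC (p 0%N) n).
by field; rewrite !pnatr_eq0 -!lt0n !fact_gt0.
Qed.

(** * Moments of the uniform distribution on the simplex *)

Lemma measurable_std_simplex (R : realType) (n : nat) :
  measurable (@std_simplex R n).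
Proof.
rewrite (_ : @std_simplex R n = [set x | forall i, 0 <= tnth x i] `&`
    (fun x : n.-tuple R => \sum_(i < n) tnth x i) @^-1` [set 1]) //.
apply: measurableI; first exact: measurable_tuple_nonneg.
by rewrite -[X in measurable X]setTI; exact: measurable_tuple_sum.
Qed.

(** * The simplex in the affine chart *)

Section hyperplane_chart.
Context (R : realType) (n : nat).
Implicit Type x : n.-tuple R.

Lemma tnth_hyperplane_chart0 x :
  tnth (@hyperplane_chart R n.+1 x) ord0 = 1 - \sum_(i < n) tnth x i.
Proof. by rewrite tnth_mktuple /= big_tuple. Qed.

Lemma tnth_hyperplane_chartS x i :
  tnth (@hyperplane_chart R n.+1 x) (lift ord0 i) = tnth x i.
Proof. by rewrite tnth_mktuple /= (tnth_nth 0). Qed.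

Lemma measurable_hyperplane_chart :
  measurable_fun setT (@hyperplane_chart R n.+1).
Proof.
apply/measurable_fun_tnthP => i; have [j ->|->] := unliftP ord0 i.
  rewrite (_ : _ \o _ = (@tnth n R)^~ j); first exact: measurable_tnth.
  by apply/funext => x; exact: tnth_hyperplane_chartS.
rewrite (_ : _ \o _ = fun x => 1 - \sum_(i < n) tnth x i).
  by apply: measurable_funB => //; exact: measurable_tuple_sum.
by apply/funext => x; exact: tnth_hyperplane_chart0.
Qed.

(** In the chart the coordinates always sum to 1, and nonnegativity of coordinate 0 becomes the
    bound 1 on the sum of the others. *)
Lemma preimage_hyperplane_chart_simplex :
  @hyperplane_chart R n.+1 @^-1` (@std_simplex R n.+1) = corner_simplex 1.
Proof.
apply/seteqP; split => x; rewrite /std_simplex /corner_simplex /=.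
  move=> [x0 _]; split.
    by move=> i; rewrite -tnth_hyperplane_chartS; exact: x0.
  by have := x0 ord0; rewrite tnth_hyperplane_chart0 subr_ge0.
move=> [x0 x1]; split.
  move=> i; have [j ->|->] := unliftP ord0 i.
    by rewrite tnth_hyperplane_chartS.
  by rewrite tnth_hyperplane_chart0 subr_ge0.
rewrite big_ord_recl tnth_hyperplane_chart0.
by under [X in _ + X]eq_bigr do rewrite tnth_hyperplane_chartS; rewrite subrK.
Qed.

Lemma hyperplane_lebesgueE :
  @hyperplane_lebesgue R n.+1 =
  pushforward (lebesgue_tuple_measure R n) (@hyperplane_chart R n.+1).
Proof. by rewrite /hyperplane_lebesgue /= lebesgue_tuple_measureE. Qed.

(** Coordinate 0 is 1 minus the sum of the others, so this is Dirichlet's integral at [t = 1] with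
    [q = p 0] and the exponents shifted by one. *)
Lemma integral_monomial_hyperplane_chart (p : nat -> nat) :
  (\int[lebesgue_tuple_measure R n]_(x in corner_simplex 1)
     (\prod_(i < n.+1) tnth (@hyperplane_chart R n.+1 x) i ^+ p i)%:E =
   ((\prod_(i < n.+1) (p i)`!)%:R / (n + \sum_(i < n.+1) p i)`!%:R)%:E)%E.
Proof.
rewrite integral_mkcond.
transitivity (\int[lebesgue_tuple_measure R n]_x
    (dirichlet_density (fun i => p i.+1) (p 0%N) 1 x)%:E)%E.
  apply: eq_integral => x _; rewrite patchE /dirichlet_density indicE.
  case: (x \in _); rewrite ?mul1r ?mul0r//; congr EFin.
  rewrite big_ord_recl tnth_hyperplane_chart0 mulrC.
  by under eq_bigr do rewrite tnth_hyperplane_chartS.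
rewrite integral_dirichlet ler01 mul1r expr1n mulr1 !big_ord_recl; congr EFin.
by rewrite -natrM mulnC -addnA (addnC (p 0%N)).
Qed.

Lemma hyperplane_lebesgue_simplex :
  @hyperplane_lebesgue R n.+1 (@std_simplex R n.+1) = (n`!%:R^-1)%:E.
Proof.
rewrite hyperplane_lebesgueE /pushforward preimage_hyperplane_chart_simplex.
(* The volume is the integral of the monomial with all exponents 0. *)
have := integral_monomial_hyperplane_chart (fun=> 0%N).
rewrite big1 ?big1// addn0 div1r => <-.
under eq_integral do rewrite big1//.
by rewrite integral_cst ?mul1e//; exact: measurable_corner_simplex.
Qed.

End hyperplane_chart.

Section uniform_simplex_moments.
Context (R : realType) (n : nat) (d : measure_display) (T : measurableType d)
  (P : probability T R) (a : {RV P >-> n.+1.-tuple R}).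
Hypothesis a_unif : uniform_simplex a.

Let S := a @^-1` (@std_simplex R n.+1).

Let measurable_S : measurable S.
Proof.
by rewrite -[S]setTI; apply: measurable_funPT => //; exact: measurable_std_simplex.
Qed.

Lemma uniform_simplexE (A : set (n.+1.-tuple R)) : measurable A ->
  A `<=` @std_simplex R n.+1 ->
  distribution P a A = (n`!%:R%:E * @hyperplane_lebesgue R n.+1 A)%E.
Proof.
move=> mA AS; rewrite a_unif// hyperplane_lebesgue_simplex /= invrK muleC.
by rewrite setIidl.
Qed.

Lemma uniform_simplex_setC : P (~` S) = 0.
Proof.
rewrite probability_setC//.
have -> : P S = distribution P a (@std_simplex R n.+1) by [].
rewrite uniform_simplexE//; last exact: measurable_std_simplex.
by rewrite hyperplane_lebesgue_simplex -EFinM divff ?subee// pnatr_eq0 -lt0n fact_gt0.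
Qed.

(** Two changes of variables: from [P] to the law of [a], then through the chart. The factor is the
    inverse of the volume of the simplex. *)
Lemma uniform_simplex_ge0_integral (f : n.+1.-tuple R -> \bar R) :
  measurable_fun [set: n.+1.-tuple R] f ->
  (forall x, @std_simplex R n.+1 x -> (0 <= f x)%E) ->
  (\int[P]_(w in S) f (a w) =
   n`!%:R%:E * \int[lebesgue_tuple_measure R n]_(x in corner_simplex 1)
                 f (@hyperplane_chart R n.+1 x))%E.
Proof.
move=> mf f0.
have mS := @measurable_std_simplex R n.+1.
have mfS : measurable_fun (@std_simplex R n.+1) f by exact: measurable_funTS.
pose H : {measure set (n.+1.-tuple R) -> \bar R} :=
  measure_function_pushforward__canonical__measure_function_Measure
    (lebesgue_tuple_measure R n) (@measurable_hyperplane_chart R n).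
transitivity (\int[distribution P a]_(x in @std_simplex R n.+1) f x)%E.
  by rewrite ge0_integral_pushforward// => x; rewrite inE => /f0.
rewrite (eq_measure_integral (mscale (n`!%:R%:nng) H)); last first.
  move=> A mA AS; rewrite [LHS]uniform_simplexE//.
  by rewrite hyperplane_lebesgueE.
rewrite ge0_integral_mscale//; congr (_ * _)%E.
rewrite ge0_integral_pushforward//; last by move=> x; rewrite inE => /f0.
  by rewrite preimage_hyperplane_chart_simplex.
exact: measurable_hyperplane_chart.
Qed.

(** The monomial is nonnegative on the event [S], where its integral is finite; this gives
    integrability there, and the null complement of [S] changes nothing. *)
Lemma uniform_simplex_moment (p : nat -> nat) :
  let f w := (\prod_(i < n.+1) tnth (a w) i ^+ p i)%:E in
  P.-integrable setT f /\
  (\int[P]_w f w =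
   (n`!%:R * (\prod_(i < n.+1) (p i)`!)%:R / (n + \sum_(i < n.+1) p i)`!%:R)%:E)%E.
Proof.
move=> f.
pose g (x : n.+1.-tuple R) : R := \prod_(i < n.+1) tnth x i ^+ p i.
have mg : measurable_fun [set: n.+1.-tuple R] g.
  by apply: measurable_prod => i _; apply: measurable_funX; exact: measurable_tnth.
have mf : measurable_fun setT f.
  by apply/measurable_EFinP; exact: (measurableT_comp mg (measurable_funPT a)).
have fS : (\int[P]_(w in S) f w =
   (n`!%:R * (\prod_(i < n.+1) (p i)`!)%:R / (n + \sum_(i < n.+1) p i)`!%:R)%:E)%E.
  rewrite (@uniform_simplex_ge0_integral (EFin \o g)); first last.
  - by move=> x [x0 _]; rewrite lee_fin prodr_ge0// => i _; rewrite exprn_ge0.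
  - exact/measurable_EFinP.
  by rewrite integral_monomial_hyperplane_chart -EFinM mulrA.
have SE : setT `\` ~` S = S by rewrite setTD setCK.
have mC : measurable (~` S) by exact: measurableC.
have intf : P.-integrable setT f.
  apply/(negligible_integrable mC measurableT mf uniform_simplex_setC).
  rewrite SE; apply/integrableP; split; first exact: measurable_funTS.
  rewrite integral_fin_num_abs// ?fS//.
  by apply/measurable_EFinP; exact: measurable_funTS.
split=> //.
by rewrite (negligible_integral mC measurableT intf uniform_simplex_setC) SE.
Qed.

End uniform_simplex_moments.

(** * Mean and variance of a linear form on the simplex *)

Section uniform_simplex_linear.
Context (R : realType) (n : nat) (d : measure_display) (T : measurableType d)
  (P : probability T R) (a : {RV P >-> n.-tuple R}).
Hypothesis n_gt0 : (0 < n)%N.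
Hypothesis a_unif : uniform_simplex a.

Lemma uniform_simplex_moment1 (i : 'I_n) :
  P.-integrable setT (fun w => (tnth (a w) i)%:E) /\
  (\int[P]_w (tnth (a w) i)%:E = (n%:R^-1)%:E)%E.
Proof.
case: n a n_gt0 a_unif i => // m b _ b_unif i.
(* The exponents are the indicator of [i]. As [n] is [m.+1], the value is the ratio of the
   factorials of [m] and [m.+1], that is [1 / n]. *)
have [+ +] := uniform_simplex_moment b_unif (fun k => k == i).
have -> : (\prod_(k < m.+1) (k == i :> nat)`! = 1)%N.
  by rewrite big1// => k _; case: eqP.
have -> : (\sum_(k < m.+1) (k == i :> nat) = 1)%N.
  by rewrite (bigD1 i)//= eqxx big1// => k /negPf; rewrite val_eqE => ->.
have fE : (fun w => (\prod_(k < m.+1) tnth (b w) k ^+ (k == i :> nat))%:E) =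
    (fun w => (tnth (b w) i)%:E).
  apply/funext => w; rewrite (bigD1 i)//= eqxx big1 ?mulr1//.
  by move=> k /negPf; rewrite val_eqE => ->.
rewrite fE => intb ->; split => //; congr EFin.
have m0 : m`!%:R != 0 :> R by rewrite pnatr_eq0 -lt0n fact_gt0.
by rewrite addn1 factS natrM mulr1 invfM mulrCA divff// mulr1.
Qed.

Lemma uniform_simplex_moment2 (i j : 'I_n) :
  P.-integrable setT (fun w => (tnth (a w) i * tnth (a w) j)%:E) /\
  (\int[P]_w (tnth (a w) i * tnth (a w) j)%:E =
   ((1 + (i == j)%:R) / (n%:R * (n%:R + 1)))%:E)%E.
Proof.
case: n a n_gt0 a_unif i j => // m b _ b_unif i j.
(* The exponents add the indicators of [i] and [j]. The product of their factorials is 2 if [i = j]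
   and 1 otherwise, and they sum to 2. *)
have [+ +] := uniform_simplex_moment b_unif (fun k => (k == i) + (k == j))%N.
have -> : (\prod_(k < m.+1) ((k == i :> nat) + (k == j :> nat))`! =
    1 + (i == j))%N.
  rewrite (bigD1 i)//= eqxx big1 ?muln1; first by rewrite val_eqE; case: eqP.
  by move=> k /negPf; rewrite val_eqE => ->; case: eqP.
have sum_delta (l : 'I_m.+1) : (\sum_(k < m.+1) (k == l :> nat) = 1)%N.
  by rewrite (bigD1 l)//= eqxx big1// => k /negPf; rewrite val_eqE => ->.
have prod_delta (l : 'I_m.+1) w :
    \prod_(k < m.+1) tnth (b w) k ^+ (k == l :> nat) = tnth (b w) l.
  rewrite (bigD1 l)//= eqxx big1 ?mulr1//.
  by move=> k /negPf; rewrite val_eqE => ->.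
rewrite big_split /= !sum_delta.
have fE : (fun w => (\prod_(k < m.+1)
      tnth (b w) k ^+ ((k == i :> nat) + (k == j :> nat)))%:E) =
    (fun w => (tnth (b w) i * tnth (b w) j)%:E).
  apply/funext => w; rewrite -!prod_delta -big_split /=; congr EFin.
  by apply: eq_bigr => k _; rewrite exprD.
rewrite fE => intb ->; split => //; congr EFin.
have m0 : m`!%:R != 0 :> R by rewrite pnatr_eq0 -lt0n fact_gt0.
rewrite addn2 !factS !natrM natrD -!natr1.
by field; rewrite m0 !natr1 !pnatr_eq0.
Qed.

Variable c : 'I_n -> R.
Let Y w := \sum_(i < n) c i * tnth (a w) i.

Let Y_moment1 : P.-integrable setT (EFin \o Y) /\
  (\int[P]_w (Y w)%:E = ((\sum_(i < n) c i) / n%:R)%:E)%E.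
Proof.
have YE : EFin \o Y = fun w => (\sum_(i < n) (c i)%:E * (tnth (a w) i)%:E)%E.
  by apply/funext => w; rewrite /= /Y -sumEFin.
have int i : P.-integrable setT (fun w => (c i)%:E * (tnth (a w) i)%:E)%E.
  by apply: integrableZl => //; have [] := uniform_simplex_moment1 i.
split; first by rewrite YE; exact: integrable_sum.
rewrite (_ : (fun w => (Y w)%:E) = EFin \o Y)// YE integral_sum//.
rewrite mulr_suml -sumEFin; apply: eq_bigr => i _.
by have [inti eqi] := uniform_simplex_moment1 i; rewrite integralZl// eqi.
Qed.

Let Y_moment2 : P.-integrable setT (EFin \o (Y * Y)) /\
  (\int[P]_w ((Y * Y) w)%:E =
   ((\sum_(i < n) c i ^+ 2 + (\sum_(i < n) c i) ^+ 2) /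
    (n%:R * (n%:R + 1)))%:E)%E.
Proof.
have YE : EFin \o (Y * Y) = fun w => (\sum_(i < n) \sum_(j < n)
    (c i * c j)%:E * (tnth (a w) i * tnth (a w) j)%:E)%E.
  apply/funext => w; rewrite /= /Y fctE mulr_suml -sumEFin.
  apply: eq_bigr => i _; rewrite mulr_sumr -sumEFin.
  by apply: eq_bigr => j _; rewrite -EFinM mulrACA.
have int i j : P.-integrable setT
    (fun w => (c i * c j)%:E * (tnth (a w) i * tnth (a w) j)%:E)%E.
  by apply: integrableZl => //; have [] := uniform_simplex_moment2 i j.
have ints i : P.-integrable setT (fun w => \sum_(j < n)
    (c i * c j)%:E * (tnth (a w) i * tnth (a w) j)%:E)%E.
  exact: integrable_sum.
split; first by rewrite YE; exact: integrable_sum.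
rewrite (_ : (fun w => ((Y * Y) w)%:E) = EFin \o (Y * Y))// YE integral_sum//.
transitivity (\sum_(i < n) \sum_(j < n)
    (c i * c j * ((1 + (i == j)%:R) / (n%:R * (n%:R + 1))))%:E)%E.
  apply: eq_bigr => i _; rewrite integral_sum//; apply: eq_bigr => j _.
  by have [intij eqij] := uniform_simplex_moment2 i j; rewrite integralZl// eqij.
under eq_bigr do rewrite sumEFin.
rewrite sumEFin; congr EFin.
set D := n%:R * (n%:R + 1).
(* The diagonal terms count twice: row [i] is [c i] times the full sum, plus one further
   [c i ^+ 2]. *)
transitivity (\sum_(i < n) (c i ^+ 2 / D + c i * (\sum_(j < n) c j) / D)).
  apply: eq_bigr => i _; rewrite [LHS](bigD1 i)//= eqxx [in RHS](bigD1 i)//=.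
  under eq_bigr => j ji do rewrite eq_sym (negPf ji) addr0 mul1r.
  by rewrite -mulr_suml -mulr_sumr; ring.
by rewrite big_split /= -!mulr_suml -mulrDl expr2.
Qed.

Lemma uniform_simplex_expectation :
  'E_P[fun w => (\sum_(i < n) c i * tnth (a w) i)%R]%E =
  ((\sum_(i < n) c i) / n%:R)%:E.
Proof. by rewrite unlock; have [] := Y_moment1. Qed.

(** With [S1] and [S2] the sums of the [c i] and of their squares,
    [(S2 + S1^2) / (n (n + 1)) - S1^2 / n^2] factors as [1 / (n + 1)] times the variance of [c] at a
    uniform index. *)
Lemma uniform_simplex_variance :
  'V_P[fun w => (\sum_(i < n) c i * tnth (a w) i)%R]%E =
  ((n%:R + 1)^-1 * ((\sum_(i < n) c i ^+ 2) / n%:R -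
                    ((\sum_(i < n) c i) / n%:R) ^+ 2))%:E.
Proof.
have [int1 _] := Y_moment1; have [int2 eq2] := Y_moment2.
rewrite /variance covarianceE; [|exact/Lfun1_integrable..].
rewrite uniform_simplex_expectation unlock eq2 -EFinM -EFinB; congr EFin.
have n0 : n%:R != 0 :> R by rewrite pnatr_eq0 -lt0n.
have n1 : n%:R + 1 != 0 :> R by rewrite natr1 pnatr_eq0.
by field; rewrite n0 n1.
Qed.

End uniform_simplex_linear.

(** * Sums over permutations *)

Section permutation_sums.
Context (R : comNzRingType) (k : nat).
Implicit Types (A B : 'I_k -> R) (m : 'I_k).

(** Composing with a transposition shows that the sum over [s] is the same at every point. Adding
    over all points and exchanging sums, each [s] contributes the full sum of [B]. *)
Lemma sum_perm_eval B m :
  k%:R * (\sum_(s : {perm 'I_k}) B (s m)) = k`!%:R * \sum_(m < k) B m.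
Proof.
transitivity (\sum_(m' < k) \sum_(s : {perm 'I_k}) B (s m')).
  rewrite -[k in k%:R]card_ord mulr_natl -sumr_const; apply: eq_bigr => m' _.
  rewrite (reindex_inj (mulgI (tperm m m'))) /=.
  by apply: eq_bigr => s _; rewrite permM tpermL.
rewrite exchange_big /= -[k`!]card_Sn mulr_natl -sumr_const.
by apply: eq_bigr => s _; rewrite [RHS](reindex_inj (@perm_inj _ s)).
Qed.

Lemma sum_perm_eval2 B m m' : m != m' ->
  k%:R * (k%:R - 1) * (\sum_(s : {perm 'I_k}) B (s m) * B (s m')) =
  k`!%:R * ((\sum_(m < k) B m) ^+ 2 - \sum_(m < k) B m ^+ 2).
Proof.
move=> mm'.
have k0 : (0 < k)%N by case: k m {mm' m'} => [[]|].
have card_neq : #|[pred l : 'I_k | l != m]| = k.-1.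
  by rewrite cardC1 card_ord.
(* The transposition of [m'] and [l] fixes [m], so the sum is the same for each of the [k - 1]
   points [l] other than [m]. *)
have fixm : (k%:R - 1) * (\sum_(s : {perm 'I_k}) B (s m) * B (s m')) =
    \sum_(l < k | l != m) \sum_(s : {perm 'I_k}) B (s m) * B (s l).
  rewrite -[k in k%:R - 1]prednK// -natr1 addrK -card_neq mulr_natl -sumr_const.
  apply: eq_bigr => l lm; rewrite (reindex_inj (mulgI (tperm m' l))) /=.
  by apply: eq_bigr => s _; rewrite !permM tpermL tpermD// eq_sym.
rewrite -mulrA fixm exchange_big /=.
(* As [s] is a bijection, the values [B (s l)] over [l != m] sum to the full sum of [B] minus
   [B (s m)]. *)
transitivity (k%:R * (\sum_(s : {perm 'I_k}) B (s m)) * (\sum_(l < k) B l) -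
    k%:R * \sum_(s : {perm 'I_k}) B (s m) ^+ 2).
  rewrite -mulrA -mulrBr; congr (_ * _); rewrite mulr_suml -sumrB.
  apply: eq_bigr => s _; rewrite -mulr_sumr.
  by rewrite [\sum_(l < k) B l](reindex_inj (@perm_inj _ s)) [in RHS](bigD1 m)//=; ring.
have /= -> := sum_perm_eval (fun m => B m ^+ 2) m.
by rewrite (sum_perm_eval B m) -mulrA -expr2 mulrBr.
Qed.

Lemma sum_perm_pairing A B :
  k%:R * (\sum_(s : {perm 'I_k}) \sum_(m < k) A m * B (s m)) =
  k`!%:R * ((\sum_(m < k) A m) * (\sum_(m < k) B m)).
Proof.
rewrite exchange_big mulr_sumr mulr_suml mulr_sumr; apply: eq_bigr => m _ /=.
by rewrite -mulr_sumr mulrCA sum_perm_eval mulrCA.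
Qed.

(** Expanding the square gives pairs [(m, l)]: the diagonal is handled by [sum_perm_eval] for the
    squares of [B], the rest by [sum_perm_eval2]. *)
Lemma sum_perm_pairing2 A B :
  k%:R * (k%:R - 1) *
    (\sum_(s : {perm 'I_k}) (\sum_(m < k) A m * B (s m)) ^+ 2) =
  k`!%:R *
    ((k%:R - 1) * (\sum_(m < k) A m ^+ 2) * (\sum_(m < k) B m ^+ 2) +
     ((\sum_(m < k) A m) ^+ 2 - \sum_(m < k) A m ^+ 2) *
     ((\sum_(m < k) B m) ^+ 2 - \sum_(m < k) B m ^+ 2)).
Proof.
set SB2 := \sum_(m < k) B m ^+ 2.
set DB := (\sum_(m < k) B m) ^+ 2 - SB2.
have -> : \sum_(s : {perm 'I_k}) (\sum_(m < k) A m * B (s m)) ^+ 2 =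
    \sum_(m < k) \sum_(l < k)
      A m * A l * \sum_(s : {perm 'I_k}) B (s m) * B (s l).
  under eq_bigr do rewrite expr2 mulr_suml.
  rewrite exchange_big; apply: eq_bigr => m _ /=.
  under eq_bigr do rewrite mulr_sumr.
  rewrite exchange_big; apply: eq_bigr => l _ /=.
  by rewrite mulr_sumr; apply: eq_bigr => s _; rewrite mulrACA.
rewrite mulr_sumr.
transitivity (\sum_(m < k) (k`!%:R * ((k%:R - 1) * A m ^+ 2 * SB2) +
    k`!%:R * ((A m * (\sum_(l < k) A l) - A m ^+ 2) * DB))).
  apply: eq_bigr => m _; rewrite (bigD1 m)//= mulrDr; congr (_ + _).
    have eqm : k%:R * (\sum_(s : {perm 'I_k}) B (s m) * B (s m)) = k`!%:R * SB2.
      by rewrite -(sum_perm_eval (fun m => B m ^+ 2) m).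
    transitivity ((k%:R - 1) * A m ^+ 2 *
      (k%:R * (\sum_(s : {perm 'I_k}) B (s m) * B (s m)))); first by ring.
    by rewrite eqm; ring.
  have -> : A m * (\sum_(l < k) A l) - A m ^+ 2 = A m * \sum_(l < k | l != m) A l.
    by rewrite (bigD1 m)//=; ring.
  rewrite !mulr_sumr mulr_suml mulr_sumr; apply: eq_bigr => l lm.
  rewrite mulrCA sum_perm_eval2 1?eq_sym// -/SB2 -/DB; ring.
rewrite big_split /= -!mulr_sumr -mulrDr -!mulr_suml -mulr_sumr; congr (_ * (_ + _ * _)).
by rewrite sumrB -mulr_suml expr2.
Qed.

End permutation_sums.

(** * Moments of functions of a uniform permutation *)

Section uniform_perm_moments.
Context (R : realType) (k : nat) (d : measure_display) (T : measurableType d)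
  (P : probability T R) (s : T -> {perm 'I_k}).
Hypothesis s_unif : uniform_perm P s.

Lemma uniform_perm_integral (f : {perm 'I_k} -> R) :
  P.-integrable setT (fun w => (f (s w))%:E) /\
  (\int[P]_w (f (s w))%:E = ((\sum_t f t) / k`!%:R)%:E)%E.
Proof.
(* The hypothesis gives only the probabilities of the events [s = t], so the function is decomposed
   along their indicators. *)
have fE : (fun w => (f (s w))%:E) =
    (fun w => \sum_t (f t)%:E * (\1_(s @^-1` [set t]) w)%:E)%E.
  apply/funext => w; rewrite (bigD1 (s w))//= big1.
    by rewrite indicE mem_set// mule1 adde0.
  move=> t tsw; rewrite indicE memNset ?mule0//= => sw.
  by rewrite sw eqxx in tsw.
have int t : P.-integrable setT
    (fun w => (f t)%:E * (\1_(s @^-1` [set t]) w)%:E)%E.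
  apply: integrableZl => //; apply: integrable_indic => //.
    exact: (s_unif t).1.
split; first by rewrite fE; exact: integrable_sum.
rewrite fE integral_sum// mulr_suml -sumEFin; apply: eq_bigr => t _.
have [mt Pt] := s_unif t.
rewrite integralZl//; last exact: integrable_indic.
rewrite integral_indic// setIT EFinM -card_Sn; congr (_ * _)%E; exact: Pt.
Qed.

Lemma uniform_perm_expectation (f : {perm 'I_k} -> R) :
  'E_P[fun w => f (s w)]%E = ((\sum_t f t) / k`!%:R)%:E.
Proof. by rewrite unlock; have [] := uniform_perm_integral f. Qed.

Lemma uniform_perm_variance (f : {perm 'I_k} -> R) :
  'V_P[fun w => f (s w)]%E =
  ((\sum_t f t ^+ 2) / k`!%:R - ((\sum_t f t) / k`!%:R) ^+ 2)%:E.
Proof.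
have [int1 _] := uniform_perm_integral f.
have [int2 _] := uniform_perm_integral (fun t => f t ^+ 2).
have sqE : (fun w => f (s w)) * (fun w => f (s w)) = (fun w => f (s w) ^+ 2).
  by apply/funext => w; rewrite expr2.
rewrite /variance covarianceE ?sqE; [|exact/Lfun1_integrable..].
by rewrite (uniform_perm_expectation (fun t => f t ^+ 2)) uniform_perm_expectation.
Qed.

End uniform_perm_moments.

(** * Averages of the discrete copula over all permutations *)

Section discrete_copula_sums.
Context (R : realType) (k : nat).
Implicit Types i j : 'I_k.+1.

(** The form required by the pairing sums, with [A] and [B] the indicators of initial segments. *)
Lemma discrete_copulaE (s : {perm 'I_k}) i j :
  discrete_copula R s i j =
  k%:R^-1 * \sum_(m < k) (m < i)%N%:R * (s m < j)%N%:R.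
Proof.
rewrite /discrete_copula cardsE -sum1_card natr_sum big_mkcond; congr (_ * _).
by apply: eq_bigr => m _; rewrite unfold_in; case: (m < i)%N; case: (s m < j)%N;
  rewrite ?mulr1 ?mulr0.
Qed.

Lemma sum_ltn_ord i : \sum_(m < k) (m < i)%N%:R = i%:R :> R.
Proof.
have ik : (i <= k)%N by rewrite -ltnS ltn_ord.
rewrite -natr_sum; congr (_%:R); move: (nat_of_ord i) ik => l lk.
by rewrite -[RHS]card_ord -sum1_card (big_ord_widen k (fun=> 1%N) lk) [RHS]big_mkcond.
Qed.

Lemma sum_ltn_ord_sqr i : \sum_(m < k) (m < i)%N%:R ^+ 2 = i%:R :> R.
Proof.
rewrite -sum_ltn_ord; apply: eq_bigr => m _.
by case: (m < i)%N; rewrite ?expr1n ?expr0n.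
Qed.

Lemma mean_discrete_copula i j : (0 < k)%N ->
  (\sum_(s : {perm 'I_k}) discrete_copula R s i j) / k`!%:R =
  i%:R / k%:R * (j%:R / k%:R).
Proof.
move=> k_gt0.
have k0 : k%:R != 0 :> R by rewrite pnatr_eq0 -lt0n.
have kf0 : k`!%:R != 0 :> R by rewrite pnatr_eq0 -lt0n fact_gt0.
under eq_bigr do rewrite discrete_copulaE.
have := sum_perm_pairing (fun m : 'I_k => (m < i)%N%:R : R)
  (fun m : 'I_k => (m < j)%N%:R).
rewrite !sum_ltn_ord -mulr_sumr; set Q := \sum_s _ => e.
have -> : Q = k`!%:R * (i%:R * j%:R) / k%:R by rewrite -e mulrC mulKf.
by field; rewrite k0 kf0.
Qed.

Lemma variance_discrete_copula i j : (1 < k)%N ->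
  (\sum_(s : {perm 'I_k}) discrete_copula R s i j ^+ 2) / k`!%:R -
    (i%:R / k%:R * (j%:R / k%:R)) ^+ 2 =
  i%:R / k%:R * (j%:R / k%:R) * (1 - i%:R / k%:R) * (1 - j%:R / k%:R) /
    (k%:R - 1).
Proof.
move=> k_gt1.
have k0 : k%:R != 0 :> R by rewrite pnatr_eq0 -lt0n ltnW.
have k1 : k%:R - 1 != 0 :> R by rewrite subr_eq0 pnatr_eq1 gtn_eqF.
have kf0 : k`!%:R != 0 :> R by rewrite pnatr_eq0 -lt0n fact_gt0.
under eq_bigr do rewrite discrete_copulaE exprMn.
have := sum_perm_pairing2 (fun m : 'I_k => (m < i)%N%:R : R)
  (fun m : 'I_k => (m < j)%N%:R).
rewrite !sum_ltn_ord !sum_ltn_ord_sqr -mulr_sumr.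
set Q := \sum_s _ => e.
(* Solves [e] for [Q]; the sums of squares are again [i] and [j] because indicators are
   idempotent. *)
have -> : Q = k`!%:R * ((k%:R - 1) * i%:R * j%:R +
    (i%:R ^+ 2 - i%:R) * (j%:R ^+ 2 - j%:R)) / (k%:R * (k%:R - 1)).
  by rewrite -e mulrC mulKf// mulf_neq0.
by field; rewrite k0 k1 kf0.
Qed.

End discrete_copula_sums.

(** Reindexing by coordinates turns [Y] into a linear form in the tuple of weights, to which the
    simplex moments apply. *)
Lemma random_copula_YE (R : realType) (k : nat) (T : Type)
    (a : T -> #|{: {perm 'I_k}}|.-tuple R) (i j : 'I_k.+1) :
  random_copula_Y a i j = fun w =>
    \sum_(l < #|{: {perm 'I_k}}|)
      discrete_copula R (enum_val l) i j * tnth (a w) l.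
Proof.
apply/funext => w; rewrite /random_copula_Y /weight.
rewrite (reindex_onto enum_val enum_rank) => [|? _]; last by rewrite enum_rankK.
by apply: eq_big => l; rewrite enum_valK ?eqxx// mulrC.
Qed.

Theorem theorem4p3 (R : realType) (k : nat) (hk : (2 <= k)%N)
    (dX : measure_display) (TX : measurableType dX) (PX : probability TX R)
    (s : TX -> {perm 'I_k}) (s_unif : uniform_perm PX s)
    (dY : measure_display) (TY : measurableType dY) (PY : probability TY R)
    (alpha : {RV PY >-> #|{: {perm 'I_k}}|.-tuple R})
    (alpha_unif : uniform_simplex alpha)
    (i j : 'I_k.+1) :
  let u : R := i%:R / k%:R in
  let v : R := j%:R / k%:R in
  let X := @random_copula_X R k TX s i j in
  let Y := @random_copula_Y R k TY alpha i j in
  ('E_PY[Y] = 'E_PX[X] /\ 'E_PX[X] = (u * v)%:E /\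
   'V_PY[Y] = ((k`!%:R + 1)^-1)%:E * 'V_PX[X] /\
   ((k`!%:R + 1)^-1)%:E * 'V_PX[X] =
     (u * v * (1 - u) * (1 - v) / ((k`!%:R + 1) * (k%:R - 1)))%:E)%E.
Proof.
move=> u v X Y.
have k_gt0 : (0 < k)%N by apply: ltnW.
have N_gt0 : (0 < #|{: {perm 'I_k}}|)%N by rewrite card_Sn fact_gt0.
pose c (t : {perm 'I_k}) := discrete_copula R t i j.
have sum_enum (f : {perm 'I_k} -> R) :
    \sum_(l < #|{: {perm 'I_k}}|) f (enum_val l) = \sum_t f t.
  by rewrite [RHS](reindex_onto enum_val enum_rank) => [|? _];
    [apply: eq_bigl => l; rewrite enum_valK eqxx | rewrite enum_rankK].
have EX : ('E_PX[X] = (u * v)%:E)%E.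
  by rewrite (uniform_perm_expectation s_unif c) mean_discrete_copula.
have VX : ('V_PX[X] = (u * v * (1 - u) * (1 - v) / (k%:R - 1))%:E)%E.
  rewrite (uniform_perm_variance s_unif c) mean_discrete_copula//.
  by rewrite variance_discrete_copula.
have EY : ('E_PY[Y] = (u * v)%:E)%E.
  rewrite /Y random_copula_YE uniform_simplex_expectation//.
  by rewrite (sum_enum c) card_Sn mean_discrete_copula.
have VY : ('V_PY[Y] = ((k`!%:R + 1)^-1 *
    (u * v * (1 - u) * (1 - v) / (k%:R - 1)))%:E)%E.
  rewrite /Y random_copula_YE uniform_simplex_variance//.
  (* With [k!] coordinates, the bracket in [uniform_simplex_variance] is the variance of the copula
     at a uniform permutation, that is of [X]. *)
  rewrite (sum_enum c) (sum_enum (fun t => c t ^+ 2)) card_Sn.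
  by rewrite mean_discrete_copula// variance_discrete_copula.
split; first by rewrite EX EY.
split=> //; rewrite VX VY -EFinM; split=> //; congr EFin.
by rewrite invfM; ring.
Qed.
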